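(* For an integer $m\ge0$ let $\mathbf{S}_m=\{1,\dots,m\}^2$, and let $A_{\mathbf{S}}(m,k)$ be the number of $k$-element subsets of $\mathbf{S}_m$ such that no two distinct elements $(i,j),(i',j')$ satisfy $i=i'$ or $i-j=i'-j'$. For integers $k\ge0$ and $0\le d\le 2k$ define $$c_d(k)=\sum_{i=d}^{2k}\frac{(-1)^{i-d}}{i!}\left[{i\atop d}\right]\sum_{j=0}^{U(i,k)}\alpha(k,j)\sum_{p=L(i,k)}^{k-j}\left\{\!\!\left\{ {p+k-j \atop p}\right\}\!\!\right\}\sum_{b=0}^{j}\binom{p}{b}\binom{k}{j-b}\binom{b}{k+p-i},$$ where $\alpha(k,j)=2^{k-2j}\left[\binom{k-j}{j-1}+\binom{k-j+1}{j}\right]j!$, $U(i,k)=\min(\lceil k/2\rceil,2k-i)$ and $L(i,k)=\max(0,i-k)$. Then for all integers $m,k\ge0$, $A_{\mathbf{S}}(m,k)=\sum_{d=0}^{2k}c_d(k)\,m^d$.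
   Context: $\left[{i\atop d}\right]$ is the unsigned Stirling number of the first kind. $\left\{\!\!\left\{ {n \atop r}\right\}\!\!\right\}$ is the associated Stirling number of the second kind, defined for integers $n,r\ge0$ by $\left\{\!\!\left\{ {n \atop r}\right\}\!\!\right\}=r\left\{\!\!\left\{ {n-1 \atop r}\right\}\!\!\right\}+(n-1)\left\{\!\!\left\{ {n-2 \atop r-1}\right\}\!\!\right\}$ with $\left\{\!\!\left\{ {0 \atop r}\right\}\!\!\right\}=\delta_{r0}$, $\left\{\!\!\left\{ {1 \atop r}\right\}\!\!\right\}=0$, $\left\{\!\!\left\{ {n \atop 0}\right\}\!\!\right\}=\delta_{n0}$ (number of partitions of an $n$-set into $r$ blocks each of size at least 2). Binomial coefficients are extended to all integers (Kronenburg's convention): $\binom{n}{r}=n(n-1)\cdots(n-r+1)/r!$ if $r\ge0$; $\binom{n}{r}=(-1)^{n-r}\binom{-r-1}{n-r}$ if $r\le n<0$; $0$ otherwise (in particular $\binom{n}{r}=0$ for $n\ge0$, $r<0$). *)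

(* Defs.v *)
From HB Require Import structures.
From mathcomp Require Import all_boot all_order all_algebra.
Set Implicit Arguments. Unset Strict Implicit. Unset Printing Implicit Defensive.
Import Order.TTheory GRing.Theory Num.Theory.

Fixpoint stirling1 (n k : nat) {struct n} : nat :=
  match n, k with
  | 0, 0 => 1
  | 0, _.+1 => 0
  | _.+1, 0 => 0
  | n'.+1, k'.+1 => n' * stirling1 n' k + stirling1 n' k'
  end.

Fixpoint assoc_stirling2 (n r : nat) {struct n} : nat :=
  match n with
  | 0 => if r == 0 then 1 else 0
  | 1 => 0
  | (S (S n2 as n1)) =>
      match r with
      | 0 => 0
      | r'.+1 => r * assoc_stirling2 n1 r + n1 * assoc_stirling2 n2 r'
      end
  end.

Local Open Scope ring_scope.

(* Binomial coefficient extended to all integers (Kronenburg's convention),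
   valued in rat. *)
Definition binomZ (n r : int) : rat :=
  if (0 <= r) then
    (\prod_(i < `|r|%N) (n%:~R - i%:R)) / (`|r|%N)`!%:R
  else if (r <= n) && (n < 0) then
    (-1) ^+ `|n - r|%N * ('C(`|- r - 1|%N, `|n - r|%N))%:R
  else 0.

(* The board S_m = {1..m}^2, represented (shifted by one) as 'I_m * 'I_m.
   A subset is admissible when no two distinct elements share the row i or
   the difference i - j. *)
Definition admissibleS (m : nat) (S : {set 'I_m * 'I_m}) : bool :=
  [forall x in S, forall y in S,
     (x != y) ==> ((x.1 != y.1) &&
                   ((x.1 : nat)%:Z - (x.2 : nat)%:Z != (y.1 : nat)%:Z - (y.2 : nat)%:Z))].

Definition A_S (m k : nat) : nat :=
  #|[set S : {set 'I_m * 'I_m} | (#|S| == k)%N && admissibleS S]|.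

Definition alpha (k j : nat) : rat :=
  (2%:Q) ^ (k%:Z - (2 * j)%:Z) *
  (binomZ (k%:Z - j%:Z) (j%:Z - 1) + binomZ (k%:Z - j%:Z + 1) j%:Z) * (j`!)%:R.

Definition Ubound (i k : nat) : nat := minn (uphalf k) (2 * k - i).
Definition Lbound (i k : nat) : nat := maxn 0 (i - k).

Definition c_coef (d k : nat) : rat :=
  \sum_(d <= i < (2 * k).+1)
    ((-1) ^+ (i - d) / (i`!)%:R * (stirling1 i d)%:R *
     \sum_(0 <= j < (Ubound i k).+1)
       (alpha k j *
        \sum_(Lbound i k <= p < (k - j).+1)
          ((assoc_stirling2 (p + k - j) p)%:R *
           \sum_(0 <= b < j.+1)
             (binomZ p%:Z b%:Z * binomZ k%:Z (j%:Z - b%:Z) *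
              binomZ b%:Z (k%:Z + p%:Z - i%:Z))))).

(* Main.v *)
Require Import Defs.
From HB Require Import structures.
From mathcomp Require Import all_boot all_order all_algebra.
From mathcomp Require Import ring zify.
Import Order.TTheory GRing.Theory Num.Theory.
Local Open Scope ring_scope.

(** A cell (i, j) lies in row i and on the diagonal i - j; call it low if
    j <= i. Label each row by the kind of its chosen cell (low, high or none).
    The diagonals meeting the low part of row i increase with i and those
    meeting the high part decrease, and no diagonal is of both kinds, so the
    number of admissible sets with a given labelling is a product over the rows.
    Shift the two products by parameters a and b. Reading the labelling from the
    first row and from the last row gives two recurrences for the refined count
    W_m(u, l; a, b); since the dependence on a and b is explicit, each becomes a
    recurrence at a = 1, b = 0. Their sum only involves u + l:
      2 A(m+1, k) = 2 A(m, k) + (4 m + 5 - 3 k) A(m, k-1)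
                    + (m + 2 - k) (2 m + 3 - k) A(m, k-2).

    On the other side, Vandermonde's and Nanjundiah's identities reduce the
    right-hand side, with n = m - k, to
      (1 / n!) sum_j beta(k, j) (n + j)! S(m, n + j),   alpha(k, j) = beta(k, j) j!,
    that is, to m!/n! times the coefficient of z^m in E^n P_k(E), where
    E = exp z - 1 and P_k(y) = sum_j beta(k, j) y^j
    = ((1 + s)^(k+1) + (1 - s)^(k+1)) / 2 with s^2 = 1 + y. A first order
    differential equation for P_k gives the same recurrence. *)

(** * Recurrences for the refined count W from both ends of the board *)

(* W_m(u, l; a, b), defined by the recurrence on the first row; the
   correspondence with labellings is [wordsumE]. *)
Fixpoint wordsum (m u l : nat) (a b : rat) : rat :=
  if m is m'.+1 then
    wordsum m' u l (a + 1) b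
    + (if l is l'.+1 then a * wordsum m' u l' a b else 0)
    + (if u is u'.+1 then (b + m'%:R - u'%:R) * wordsum m' u' l (a + 1) b else 0)
  else ((u == 0%N) && (l == 0%N))%:R.

Lemma wordsumS m u l a b :
  wordsum m.+1 u l a b =
    wordsum m u l (a + 1) b
    + (if l is l'.+1 then a * wordsum m u l' a b else 0)
    + (if u is u'.+1 then (b + m%:R - u'%:R) * wordsum m u' l (a + 1) b else 0).
Proof. by []. Qed.

(** The recurrence on the last row. It follows by induction because removing the first row and
    removing the last row commute: expanding either recurrence by the other gives the same terms. *)
Lemma wordsumS_last m u l a b :
  wordsum m.+1 u l a b =
    wordsum m u l a (b + 1)
    + (if u is u'.+1 then b * wordsum m u' l a b else 0)
    + (if l is l'.+1 then (a + m%:R - l'%:R) * wordsum m u l' a (b + 1) else 0).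
Proof.
elim: m u l a b => [|m IH] u l a b.
  by case: u => [|[|u]]; case: l => [|[|l]] /=; ring.
case: u => [|[|u]]; case: l => [|[|l]];
  by rewrite [LHS]wordsumS ![in LHS]IH ![in RHS]wordsumS; ring.
Qed.

(** Reversing the order of the rows exchanges low with high and a with b, hence the first-row
    recurrence with the last-row one. *)
Lemma wordsum_sym m u l a b : wordsum m u l a b = wordsum m l u b a.
Proof.
elim: m u l a b => [|m IH] u l a b; first by rewrite /= andbC.
rewrite wordsumS wordsumS_last.
by case: u => [|u]; case: l => [|l]; rewrite !(IH _ _ _ b); ring.
Qed.

Lemma wordsumDl m u l a b :
  wordsum m u l (a + 1) b =
  wordsum m u l a b
  + (if l is l'.+1 then (m%:R - u%:R - l'%:R) * wordsum m u l' a b else 0).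
Proof.
elim: m u l a b => [|m IH] u l a b.
  by case: u => [|[|u]]; case: l => [|[|l]] /=; ring.
rewrite !wordsumS.
by case: u => [|u]; case: l => [|[|l]]; rewrite !(IH _ _ (a + 1)) ?wordsumS ?(IH _ _ a); ring.
Qed.

Lemma wordsumDr m u l a b :
  wordsum m u l a (b + 1) =
  wordsum m u l a b
  + (if u is u'.+1 then (m%:R - u'%:R - l%:R) * wordsum m u' l a b else 0).
Proof.
rewrite wordsum_sym wordsumDl (wordsum_sym m u l); case: u => [|u] //.
by rewrite (wordsum_sym m u l); ring.
Qed.

(** The sum of the first-row and last-row recurrences, with every shifted parameter brought back to
    a or b by [wordsumDl] and [wordsumDr]. *)
Lemma wordsumS_double m u l a b :
  2 * wordsum m.+1 u l a b =
    2 * wordsum m u l a b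
    + (if l is l'.+1 then (2 * a + 2 * m%:R - u%:R - 2 * l'%:R) * wordsum m u l' a b
       else 0)
    + (if u is u'.+1 then (2 * b + 2 * m%:R - l%:R - 2 * u'%:R) * wordsum m u' l a b
       else 0)
    + (if u is u'.+1 then if l is l'.+1 then
         (a + b + 2 * m%:R - u'%:R - l'%:R) * (m%:R - u'%:R - l'%:R)
         * wordsum m u' l' a b else 0 else 0).
Proof.
rewrite mulr2n mulrDl !mul1r [X in X + _]wordsumS [X in _ + X]wordsumS_last.
by case: u => [|u]; case: l => [|l]; rewrite !wordsumDl ?wordsumDr; ring.
Qed.

(** * Summation over u + l = k and the recurrence for the total count *)

Definition antidiag (k : nat) (f : nat -> nat -> rat) : rat :=
  \sum_(l < k.+1) f (k - l)%N l.

Lemma eq_antidiag k f g :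
  (forall u l, (u + l = k)%N -> f u l = g u l) -> antidiag k f = antidiag k g.
Proof. by move=> E; apply: eq_bigr => l _; apply: E; rewrite subnK // -ltnS. Qed.

Lemma antidiagD k f g :
  antidiag k (fun u l => f u l + g u l) = antidiag k f + antidiag k g.
Proof. exact: big_split. Qed.

Lemma antidiagZ k c f : antidiag k (fun u l => c * f u l) = c * antidiag k f.
Proof. by rewrite /antidiag mulr_sumr. Qed.

Lemma antidiag_shiftr k f :
  antidiag k (fun u l => if l is l'.+1 then f u l' else 0) =
  if k is k'.+1 then antidiag k' f else 0.
Proof.
rewrite /antidiag big_ord_recl add0r; case: k => [|k]; first by rewrite big_ord0.
by apply: eq_bigr => l _; rewrite /= /bump /= add1n subSS.
Qed.

Lemma antidiag_shiftl k f :
  antidiag k (fun u l => if u is u'.+1 then f u' l else 0) =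
  if k is k'.+1 then antidiag k' f else 0.
Proof.
rewrite /antidiag big_ord_recr /= subnn addr0; case: k => [|k]; first by rewrite big_ord0.
by apply: eq_bigr => l _; rewrite /= subSn // -ltnS.
Qed.

(** At a = 1, b = 0 the parts of the rows have their sizes on the board: i + 1 low and m - i - 1
    high cells in row i, rows counted from 0. *)
Definition wordtotal (m k : nat) : rat :=
  antidiag k (fun u l => wordsum m u l 1 0).

Lemma wordtotalS m k :
  2 * wordtotal m.+1 k =
    2 * wordtotal m k
    + (if k is k'.+1 then (4 * m%:R + 2 - 3 * k'%:R) * wordtotal m k' else 0)
    + (if k is k'.+2 then (m%:R - k'%:R) * (2 * m%:R + 1 - k'%:R) * wordtotal m k'
       else 0).
Proof.
pose w u l := wordsum m u l 1 0.
pose f1 u l := (2 * 1 + 2 * m%:R - u%:R - 2 * l%:R) * w u l.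
pose f2 u l := (2 * 0 + 2 * m%:R - l%:R - 2 * u%:R) * w u l.
pose f3 u l := (1 + 0 + 2 * m%:R - u%:R - l%:R) * (m%:R - u%:R - l%:R) * w u l.
rewrite -antidiagZ (eq_antidiag k _ _ (fun u l _ => wordsumS_double m u l 1 0)).
rewrite !antidiagD antidiagZ (antidiag_shiftr k f1) (antidiag_shiftl k f2).
rewrite (antidiag_shiftl k (fun u l => if l is l'.+1 then f3 u l' else 0)).
case: k => [|k]; first by rewrite !addr0.
rewrite (antidiag_shiftr k f3) -(addrA _ (antidiag k f1)) -antidiagD.
congr (_ + _ + _).
  (* The coefficients of [f1] and [f2] add up to 4 m + 2 - 3 (u + l), which is constant on the
     antidiagonal. *)
  rewrite -antidiagZ; apply: eq_antidiag => u l <-; rewrite /f1 /f2 /w natrD; ring.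
case: k => [|k] //.
by rewrite -antidiagZ; apply: eq_antidiag => u l <-; rewrite /f3 /w natrD; ring.
Qed.

(** * The polynomials P_k and the coefficients of p(exp z - 1) *)

(* The polynomial P_(k-1), with P_(-1) = 1. *)
Fixpoint chebpoly (k : nat) : {poly rat} :=
  match k with
  | 0 | 1 => 1
  | (k''.+1 as k').+1 => 2%:R * chebpoly k' + 'X * chebpoly k''
  end.

Lemma chebpolySS k : chebpoly k.+2 = 2%:R * chebpoly k.+1 + 'X * chebpoly k.
Proof. by []. Qed.

Lemma deriv_natl (R : nzRingType) c (p : {poly R}) :
  (c%:R * p)^`() = c%:R * p^`().
Proof. by rewrite !mulr_natl derivMn. Qed.

(** With s^2 = 1 + y the operator 2 (1 + y) d/dy is s d/ds, which sends (1 + s)^(k+1) to (k+1) ((1 +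
    s)^(k+1) - (1 + s)^k), and likewise for -s. The proof stays with polynomials in y and carries
    two consecutive indices, the recurrence being of order two. *)
Lemma chebpoly_deriv k :
  2%:R * (1 + 'X) * (chebpoly k.+1)^`() = k.+1%:R * (chebpoly k.+1 - chebpoly k).
Proof.
suff [] : 2%:R * (1 + 'X) * (chebpoly k.+1)^`() = k.+1%:R * (chebpoly k.+1 - chebpoly k)
  /\ 2%:R * (1 + 'X) * (chebpoly k.+2)^`() = k.+2%:R * (chebpoly k.+2 - chebpoly k.+1) by [].
elim: k => [|k [IH1 IH2]]; last split=> //.
  by rewrite /= !derivE; split; ring.
rewrite chebpolySS derivD deriv_natl derivM derivX.
have -> : 2%:R * (1 + 'X) * (2%:R * (chebpoly k.+2)^`()
      + (1 * chebpoly k.+1 + 'X * (chebpoly k.+1)^`()))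
  = 2%:R * (2%:R * (1 + 'X) * (chebpoly k.+2)^`()) + 2%:R * (1 + 'X) * chebpoly k.+1
    + 'X * (2%:R * (1 + 'X) * (chebpoly k.+1)^`()) by ring.
by rewrite IH1 IH2 chebpolySS; ring.
Qed.

(* [umbral m p] is m! times the coefficient of z^m in p(exp z - 1). *)
Fixpoint umbral (m : nat) (p : {poly rat}) : rat :=
  if m is m'.+1 then umbral m' ((1 + 'X) * p^`()) else p.[0].

Lemma umbralS m p : umbral m.+1 p = umbral m ((1 + 'X) * p^`()).
Proof. by []. Qed.

Lemma umbralD m p q : umbral m (p + q) = umbral m p + umbral m q.
Proof.
by elim: m p q => [|m IH] p q /=; rewrite ?hornerD // derivD mulrDr IH.
Qed.

Lemma umbralZ m c p : umbral m (c *: p) = c * umbral m p.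
Proof.
by elim: m p => [|m IH] p /=; rewrite ?hornerZ // derivZ -scalerAr IH.
Qed.

Lemma umbral_natl m c p : umbral m (c%:R * p) = c%:R * umbral m p.
Proof. by rewrite -umbralZ scaler_nat mulr_natl. Qed.

Lemma umbral_sum m (I : Type) (r : seq I) (P : pred I) (F : I -> {poly rat}) :
  umbral m (\sum_(i <- r | P i) F i) = \sum_(i <- r | P i) umbral m (F i).
Proof.
apply: (big_morph _ (umbralD m)).
by rewrite -(scale0r 0) umbralZ mul0r.
Qed.

(** The series (exp z - 1)^a has order a in z. *)
Lemma umbral_Xn_eq0 m a p : (m < a)%N -> umbral m ('X^a * p) = 0.
Proof.
elim: m a p => [|m IH] [|a] p // ma /=.
  by rewrite hornerM hornerXn expr0n mul0r.
rewrite derivM derivXn /=.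
have -> : (1 + 'X) * (('X^a *+ a.+1) * p + 'X^(a.+1) * p^`())
  = 'X^a * ((1 + 'X) * (a.+1%:R * p + 'X * p^`())).
  by rewrite exprS; ring.
exact: IH.
Qed.

(** * Comparison of the two recurrences *)

Lemma wordtotal_eq0 m k : (m < k)%N -> wordtotal m k = 0.
Proof.
elim: m k => [|m IH] [|k] // mk.
  by rewrite /wordtotal /antidiag big1 // => -[[|l] lk] _; rewrite /= ?andbF ?subn0.
have two0 : (2 : rat) != 0 by [].
apply: (mulfI two0); rewrite wordtotalS IH 1?ltnW // (IH k) //.
case: k mk => [|k] mk; first by ring.
(* For m = k the count need not vanish, but its factor m - k does. *)
have [->|mk'] := eqVneq m k; first by ring.
by rewrite (IH k); [ring|lia].
Qed.

Lemma wordtotal_umbral n k :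
  n`!%:R * wordtotal (n + k) k = umbral (n + k) ('X^n * chebpoly k.+1).
Proof.
have two0 : (2 : rat) != 0 by [].
move Em : (n + k)%N => m; elim: m n k Em => [|m IH] n k Em.
  have [-> ->] : n = 0%N /\ k = 0%N by lia.
  by rewrite /= /wordtotal /antidiag big_ord1 /= expr0 mul1r hornerC.
apply: (mulfI two0); rewrite mulrCA wordtotalS -umbral_natl umbralS.
rewrite deriv_natl mulrA (mulrC (1 + 'X)).
case: n Em => [|n] Em.
  (* For n = 0 the first term of the recurrence is [wordtotal m m.+1 = 0], and only two polynomials
     remain. *)
  have -> : k = m.+1 by lia.
  rewrite expr0 mul1r chebpoly_deriv chebpolySS.
  have -> : m.+2%:R * (2%:R * chebpoly m.+1 + 'X * chebpoly m - chebpoly m.+1)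
    = m.+2%:R * ('X^0 * chebpoly m.+1) + m.+2%:R * ('X^1 * chebpoly m) by ring.
  rewrite umbralD !umbral_natl -(IH 0%N m) // wordtotal_eq0 //.
  case: m {Em} IH => [|m] IH; first by rewrite umbral_Xn_eq0 // fact0; ring.
  by rewrite -(IH 1%N m) // factS fact0; ring.
rewrite derivM derivXn succnK.
have -> : 2%:R * (1 + 'X) * (('X^n *+ n.+1) * chebpoly k.+1 + 'X^(n.+1) * (chebpoly k.+1)^`())
   = 2%:R * n.+1%:R * (1 + 'X) * 'X^n * chebpoly k.+1
     + 'X^(n.+1) * (2%:R * (1 + 'X) * (chebpoly k.+1)^`()) by ring.
rewrite chebpoly_deriv.
case: k Em => [|k] Em.
  have -> : 2%:R * n.+1%:R * (1 + 'X) * 'X^n * chebpoly 1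
       + 'X^(n.+1) * (1 * (chebpoly 1 - chebpoly 0))
     = (2 * n.+1)%:R * ('X^n * chebpoly 1) + 'X^(n.+1) * ((2 * n.+1)%:R * chebpoly 1).
    by rewrite /= natrM exprS; ring.
  rewrite umbralD umbral_natl -(IH n 0%N) ?umbral_Xn_eq0; [|lia|lia].
  by rewrite factS !natrM; ring.
(* In each of the three products the exponent of ['X] plus the index of P is m, so the induction
   hypothesis turns them into [wordtotal m] at k + 1, k and k - 1; for k = 0 the last product has
   order above m. *)
have -> : 2%:R * n.+1%:R * (1 + 'X) * 'X^n * chebpoly k.+2
       + 'X^(n.+1) * (k.+2%:R * (chebpoly k.+2 - chebpoly k.+1))
   = (2 * n.+1)%:R * ('X^n * chebpoly k.+2)
     + ((4 * n.+1 + k.+2)%:R * ('X^(n.+1) * chebpoly k.+1)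
     + (2 * n.+1 + k.+2)%:R * ('X^(n.+2) * chebpoly k)).
  by rewrite !natrD !natrM chebpolySS !exprS; ring.
rewrite !umbralD !umbral_natl -(IH n k.+1) -?(IH n.+1 k); [|lia|lia].
have -> : m = (n + k.+1)%N by lia.
case: k Em IH => [|k] Em IH.
  rewrite umbral_Xn_eq0 ?factS; last by lia.
  by rewrite !natrM !natrD; ring.
have -> : (n + k.+2 = m)%N by lia.
rewrite -(IH n.+2 k); last by lia.
have -> : m = (n + k.+2)%N by lia.
by rewrite !factS !natrM !natrD; ring.
Qed.

(** * Falling factorials and binomial identities *)

Lemma stirling1_small i d : (i < d)%N -> stirling1 i d = 0%N.
Proof.
elim: i d => [|i IH] [|d] // id; rewrite [stirling1 _ _]/= !IH ?muln0 //.
exact: ltnW.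
Qed.

(** The bound [N] is free because terms with d > i vanish; this gives all i the common range d <= 2
    k when sums are exchanged. *)
Lemma sum_stirling1 (R : comNzRingType) (x : R) i N : (i < N)%N ->
  \sum_(d < N) (-1) ^+ (i - d) * (stirling1 i d)%:R * x ^+ d
  = \prod_(t < i) (x - t%:R).
Proof.
elim: i N => [|i IH] [|N] // iN.
  rewrite big_ord_recl big_ord0 big1 => [|d _]; first by rewrite /= expr0; ring.
  by rewrite /= mulr0 mul0r.
rewrite [RHS]big_ord_recr -(IH N.+1) 1?ltnW // big_ord_recl /= mulr0 mul0r add0r.
rewrite mulrBr [X in X * x]big_ord_recr /= stirling1_small // mulr0 mul0r addr0.
rewrite [X in _ - X * _]big_ord_recl mulrDl.
have -> : (-1) ^+ (i - 0) * (stirling1 i 0)%:R * x ^+ 0 * i%:R = 0 :> R.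
  by case: i {IH iN} => [|i]; rewrite /= ?mulr0 ?mul0r.
rewrite add0r !mulr_suml -sumrB; apply: eq_bigr => d _.
rewrite /bump /= add1n subSS natrD natrM exprS.
have [di|id] := ltnP d i; last first.
  have [->|ne] := eqVneq (d : nat) i.
    by rewrite subnn (@stirling1_small i i.+1) // ; ring.
  by rewrite !stirling1_small; [ring|lia|lia].
by rewrite -(subnSK di) exprS; ring.
Qed.

Lemma bin_natE n r : binomZ n%:Z r%:Z = ('C(n, r))%:R.
Proof.
have r0 : (r`!%:R : rat) != 0 by rewrite pnatr_eq0 -lt0n fact_gt0.
rewrite /binomZ lez_nat /=; apply: (canLR (mulfK r0)).
rewrite -natrM bin_ffact; elim: r {r0} => [|r IH]; first by rewrite big_ord0.
rewrite big_ord_recr /= IH ffactnSr natrM.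
have [rn|nr] := leqP r n; first by rewrite natrB.
by rewrite ffact_small // !mul0r.
Qed.

Lemma bin_nat_negE n (r : int) : r < 0 -> binomZ n%:Z r = 0.
Proof. by move=> r0; rewrite /binomZ leNgt r0 (ltNge n%:Z) lez_nat andbF. Qed.

Lemma prod_natB n i : \prod_(t < i) (n%:R - t%:R) = (i`! * 'C(n, i))%:R :> rat.
Proof.
have i0 : (i`!%:R : rat) != 0 by rewrite pnatr_eq0 -lt0n fact_gt0.
by rewrite natrM -bin_natE /binomZ lez_nat /= mulrCA mulfV // mulr1.
Qed.

Lemma bin_trinomial n b c : (c <= b)%N ->
  ('C(n, b) * 'C(b, c) = 'C(n, c) * 'C(n - c, b - c))%N.
Proof.
move=> cb; have [bn|nb] := leqP b n; last first.
  rewrite (bin_small nb) mul0n; have [cn|nc] := leqP c n.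
    by rewrite (@bin_small (n - c)) ?muln0 //; lia.
  by rewrite bin_small.
apply/eqP.
rewrite -(eqn_pmul2r (fact_gt0 c)) -(eqn_pmul2r (fact_gt0 (b - c))).
rewrite -(eqn_pmul2r (fact_gt0 (n - b))); apply/eqP.
have E1 := bin_fact bn; have E2 := bin_fact cb.
have E3 := bin_fact (leq_trans cb bn).
have E4 : (b - c <= n - c)%N by lia.
move/bin_fact: E4; rewrite (_ : (n - c - (b - c) = n - b)%N); last by lia.
move=> E4.
transitivity (n`!)%N; first by rewrite -E1 -E2; ring.
by rewrite -E3 -E4; ring.
Qed.

(** The range s <= j does not depend on b, so that the sums over b and s can be exchanged below. *)
Lemma Vandermonde_le m b j N : (b <= j <= N)%N ->
  ('C(m + b, N) = \sum_(s < j.+1) 'C(b, s) * 'C(m, N - s))%N.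
Proof.
case/andP=> bj jN; rewrite addnC -binomial.Vandermonde.
rewrite [RHS](big_ord_widen N.+1 (fun s => 'C(b, s) * 'C(m, N - s)))%N //.
rewrite [RHS]big_mkcond; apply: eq_bigr => s _ /=.
by case: ltnP => // sj; rewrite bin_small // (leq_ltn_trans bj).
Qed.

(* Nanjundiah's identity. *)
Lemma sum_bin3 m k p j : (j <= k)%N ->
  (\sum_(b < j.+1) 'C(p, b) * 'C(k, j - b) * 'C(m + b, k + p)
   = 'C(m, p + (k - j)) * 'C(m + j - k, j))%N.
Proof.
move=> jk.
(* C(p, b) C(b, s) = C(p, s) C(p - s, b - s); then Vandermonde sums over b. *)
have inner s : (s <= j)%N ->
  (\sum_(b < j.+1) 'C(p, b) * 'C(k, j - b) * 'C(b, s)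
   = 'C(p, s) * 'C(k + p - s, j - s))%N.
  move=> sj; rewrite (bigID (fun b : 'I__ => s <= b)%N) /= [X in (_ + X)%N]big1 ?addn0.
    have [sp|ps] := leqP s p; last first.
      rewrite (bin_small ps) mul0n big1 // => b sb.
      by rewrite (@bin_small p) // (leq_trans ps).
    rewrite (_ : k + p - s = (p - s) + k)%N; last by lia.
    rewrite -binomial.Vandermonde big_distrr /=.
    pose F b := ('C(p, b) * 'C(k, j - b) * 'C(b, s))%N.
    rewrite -(big_mkord (fun b => s <= b)%N F).
    rewrite -(@big_nat_widenl _ _ _ s 0 j.+1 xpredT F) // -{1}[s]add0n big_addn subSn // big_mkord.
    apply: eq_bigr => b _.
    rewrite /F mulnAC bin_trinomial ?leq_addl // addnK mulnA; congr (_ * 'C(_, _))%N; lia.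
  by move=> b; rewrite -ltnNge => bs; rewrite (bin_small bs) muln0.
transitivity (\sum_(s < j.+1) 'C(m, k + p - s) * ('C(p, s) * 'C(k + p - s, j - s)))%N.
  transitivity (\sum_(b < j.+1) \sum_(s < j.+1)
      'C(m, k + p - s) * ('C(p, b) * 'C(k, j - b) * 'C(b, s)))%N.
    apply: eq_bigr => b _; rewrite (@Vandermonde_le m b j) ?big_distrr /=; last first.
      by rewrite -ltnS ltn_ord /=; lia.
    by apply: eq_bigr => s _; ring.
  rewrite exchange_big /=; apply: eq_bigr => s _.
  by rewrite -big_distrr /= inner // -ltnS.
(* Below this threshold both sides vanish; above it the subtraction in [m + j - k] is not truncated,
   and a second trinomial revision followed by Vandermonde sums over s. *)
have [cm|mc] := leqP (p + (k - j)) m; last first.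
  rewrite (bin_small mc) mul0n big1 // => s _.
  by rewrite bin_small //; have := ltn_ord s; lia.
rewrite (_ : m + j - k = p + (m - (p + (k - j))))%N; last by lia.
rewrite -binomial.Vandermonde big_distrr /=; apply: eq_bigr => s _.
have sj : (s <= j)%N by rewrite -ltnS.
rewrite -(@bin_sub (k + p - s)); last by lia.
rewrite (_ : k + p - s - (j - s) = p + (k - j))%N; last by lia.
rewrite mulnCA bin_trinomial; last by lia.
rewrite mulnCA; congr (_ * (_ * 'C(_, _)))%N; lia.
Qed.

(** * Stirling numbers of the second kind through the associated ones *)

Lemma assoc_stirling2SS n r :
  assoc_stirling2 n.+2 r.+1 =
  (r.+1 * assoc_stirling2 n.+1 r.+1 + n.+1 * assoc_stirling2 n r)%N.
Proof. by []. Qed.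

Lemma assoc_stirling2S0 n : assoc_stirling2 n.+1 0 = 0%N.
Proof. by case: n. Qed.

#[local] Arguments assoc_stirling2 : simpl never.

Lemma assoc_stirling2_small n r : (n < 2 * r)%N -> assoc_stirling2 n r = 0%N.
Proof.
suff [] : ((n < 2 * r)%N -> assoc_stirling2 n r = 0%N)
  /\ forall r', (n.+1 < 2 * r')%N -> assoc_stirling2 n.+1 r' = 0%N by [].
elim: n r => [|n IH] r; first by split; [case: r | case].
split; first by case: (IH r) => _; apply.
case=> [|r'] // nr; rewrite assoc_stirling2SS.
by rewrite (IH r').1 ?(IH r').2 ?muln0 //; lia.
Qed.

(* For q <= m, the Stirling number of the second kind S(m, m - q). *)
Definition stirling2c (m q : nat) : nat :=
  (\sum_(p < q.+1) assoc_stirling2 (p + q) p * 'C(m, p + q))%N.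

Lemma stirling2c0 m : stirling2c m 0 = 1%N.
Proof. by rewrite /stirling2c big_ord1 addn0 bin0. Qed.

(** This is S(m+1, m-q) = S(m, m-q-1) + (m-q) S(m, m-q). In [stirling2c], p counts the blocks with
    at least two elements, which cover p + q elements; Pascal's rule splits off the first term. *)
Lemma stirling2cSS m q :
  stirling2c m.+1 q.+1 = (stirling2c m q.+1 + (m - q) * stirling2c m q)%N.
Proof.
rewrite /stirling2c.
under eq_bigr => p _ do rewrite addnS binS mulnDr.
rewrite big_split /=; congr (_ + _)%N.
  by apply: eq_bigr => p _; rewrite addnS.
rewrite big_ord_recl (assoc_stirling2S0 q) mul0n add0n.
under [LHS]eq_bigr => p _ do rewrite lift0 addSn assoc_stirling2SS mulnDl.
pose F p := (p * assoc_stirling2 (p + q) p * 'C(m, p + q))%N.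
(* The index shifts by one at no cost: [F 0] has the factor 0, and [F q.+1] would need q + 1 blocks
   of size at least 2 on 2 q + 1 elements. *)
rewrite big_split /= [X in (X + _)%N](_ : _ = \sum_(p < q.+1) F p)%N; last first.
  transitivity (\sum_(p < q.+2) F p)%N.
    by rewrite [RHS]big_ord_recl /F /= mul0n add0n.
  rewrite big_ord_recr /= /F assoc_stirling2_small ?muln0 ?mul0n ?addn0 //; lia.
rewrite -big_split /= big_distrr; apply: eq_bigr => p _ /=; rewrite /F.
have [pm|mp] := leqP (p + q) m; last first.
  by rewrite !bin_small ?muln0 //; lia.
rewrite (mulnC (p + q).+1) -(mulnA _ (p + q).+1) mul_bin_left (_ : m - q = p + (m - (p + q)))%N; last by lia.
ring.
Qed.

Lemma stirling2c_diag_eq0 m q : (m <= q)%N -> (0 < q)%N -> stirling2c m q = 0%N.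
Proof.
case: q => // q mq _; rewrite /stirling2c big1 // => -[[|p] pq] _ /=.
  by rewrite add0n assoc_stirling2S0.
by rewrite bin_small ?muln0 //; lia.
Qed.

(** With n = m - q this is the exponential generating function (exp z - 1)^n / n! of the S(m, n). *)
Lemma umbral_Xn m q : (q <= m)%N ->
  umbral m 'X^(m - q) = ((m - q)`! * stirling2c m q)%:R.
Proof.
elim: m q => [|m IH] q qm.
  have -> : q = 0%N by lia.
  by rewrite stirling2c0 /= hornerC.
have [->|qm'] := eqVneq q m.+1.
  rewrite subnn umbralS derivC mulr0 stirling2c_diag_eq0 // muln0.
  by rewrite -(scale0r 0) umbralZ mul0r.
have {qm qm'} qm : (q <= m)%N by lia.
rewrite subSn // umbralS derivXn succnK.
have -> : (1 + 'X) * ('X^(m - q) *+ (m - q).+1)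
  = (m - q).+1%:R * 'X^(m - q) + (m - q).+1%:R * 'X^((m - q).+1) :> {poly rat}.
  by rewrite exprS; ring.
rewrite umbralD !umbral_natl IH // factS.
case: q qm => [|q] qm.
  by rewrite -[X in umbral m X]mulr1 umbral_Xn_eq0 ?subn0 // !stirling2c0 !natrM; ring.
rewrite subnSK // IH 1?ltnW // stirling2cSS -(subnSK qm) factS !natrM natrD natrM.
by ring.
Qed.

(** * Coefficients of P_k and the numbers alpha(k, j) *)

Lemma size_chebpoly k : (size (chebpoly k) <= (uphalf k.-1).+1)%N.
Proof.
suff [] : (size (chebpoly k) <= (uphalf k.-1).+1)%N
  /\ (size (chebpoly k.+1) <= (uphalf k).+1)%N by [].
elim: k => [|k [IH1 IH2]]; first by rewrite size_poly1.
split=> //; rewrite chebpolySS (leq_trans (size_polyD _ _)) // geq_max.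
have le_up : (uphalf k <= uphalf k.+1)%N by lia.
apply/andP; split.
  by rewrite mulr_natl -scaler_nat (leq_trans (size_scale_leq _ _)) // (leq_trans IH2).
rewrite mulrC (leq_trans (size_mul_leq _ _)) // size_polyX addn2 /=.
apply: leq_trans (IH1) _; rewrite ltnS; case: k {IH1 IH2 le_up} => [|k] //=; lia.
Qed.

Lemma coef_chebpoly k j : (j <= uphalf k)%N ->
  (chebpoly k.+1)`_j = (2%:Q) ^ (k%:Z - (2 * j)%:Z)
     * ((if j is j'.+1 then 'C(k - j, j') else 0%N) + 'C(k.+1 - j, j))%:R.
Proof.
suff [] : (forall j, (j <= uphalf k)%N ->
  (chebpoly k.+1)`_j = (2%:Q) ^ (k%:Z - (2 * j)%:Z)
     * ((if j is j'.+1 then 'C(k - j, j') else 0%N) + 'C(k.+1 - j, j))%:R)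
  /\ (forall j, (j <= uphalf k.+1)%N ->
  (chebpoly k.+2)`_j = (2%:Q) ^ (k.+1%:Z - (2 * j)%:Z)
     * ((if j is j'.+1 then 'C(k.+1 - j, j') else 0%N) + 'C(k.+2 - j, j))%:R).
  by move=> E _; exact: E.
elim: k {j} => [|k [IH1 IH2]]; split=> //.
- by case=> // _; rewrite coef1.
- by case=> [|[|j]] // _; rewrite chebpolySS /= mulr_natl mulr1 coefD coefMn coef1 coefX //.
move=> j jk; rewrite chebpolySS coefD mulr_natl coefMn coefXM.
have two0 : (2%:Q : rat) != 0 by [].
case: j jk => [|j] jk.
  rewrite IH2 // !subn0 !bin0 !subr0 /= ?addr0 add0n !mulr1.
  by rewrite -!exprnP [in RHS]exprS; ring.
have jk1 : (j <= uphalf k)%N by rewrite -ltnS; apply: leq_trans jk _.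
have jk2 : (j <= k)%N by lia.
have -> : (chebpoly k.+2)`_j.+1 = (2%:Q) ^ (k.+1%:Z - (2 * j.+1)%:Z)
     * ('C(k.+1 - j.+1, j) + 'C(k.+2 - j.+1, j.+1))%:R.
  (* The index j + 1 can exceed the degree of [chebpoly k.+2] by one; coefficient and binomials are
     then both zero. *)
  have [le|lt] := leqP j.+1 (uphalf k.+1); first by rewrite IH2.
  rewrite nth_default; last by apply: leq_trans (size_chebpoly k.+2) _; exact: lt.
  by rewrite !bin_small ?mulr0 //; lia.
rewrite /= IH1 //.
have -> : k.+2%:Z - (2 * j.+1)%:Z = k%:Z - (2 * j)%:Z by lia.
have -> : k%:Z - (2 * j)%:Z = (k.+1%:Z - (2 * j.+1)%:Z) + 1%:Z by lia.
set z := k.+1%:Z - (2 * j.+1)%:Z; clearbody z.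
rewrite expfzDr // expr1z !subSS.
have -> : (k.+1 - j = (k - j).+1)%N by lia.
have -> : (k.+2 - j = (k - j).+2)%N by lia.
by case: j {jk jk1 jk2} => [|j]; rewrite !binS ?bin0 !natrD; ring.
Qed.

Lemma alphaE k j : (j <= uphalf k)%N -> alpha k j = (chebpoly k.+1)`_j * (j`!)%:R.
Proof.
move=> jk; rewrite /alpha coef_chebpoly // natrD; congr (_ * (_ + _) * _).
  case: j jk => [|j] jk; first by rewrite subr0 bin_nat_negE.
  have -> : k%:Z - j.+1%:Z = (k - j.+1)%N%:Z by lia.
  have -> : j.+1%:Z - 1 = j%:Z by lia.
  exact: bin_natE.
have -> : k%:Z - j%:Z + 1 = (k.+1 - j)%N%:Z by lia.
exact: bin_natE.
Qed.

(** * Evaluation of the right-hand side *)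

Definition inner_coef (k j i : nat) : nat :=
  (\sum_(p < (k - j).+1) assoc_stirling2 (p + (k - j)) p *
    \sum_(b < j.+1) 'C(p, b) * 'C(k, j - b) *
      (if i <= k + p then 'C(b, k + p - i) else 0))%N.

(** The guard i <= k + p, which stands for the lower limit [Lbound i k], fails for every p <= k - j.
    Hence j may run up to [uphalf k] for all i. *)
Lemma inner_coef_eq0 k j i : (j <= k)%N -> (2 * k - i < j)%N -> inner_coef k j i = 0%N.
Proof.
move=> jk ij; rewrite /inner_coef big1 // => p _; rewrite big1 ?muln0 // => b _.
by have := ltn_ord p; case: ifP => [ik|]; rewrite ?muln0 //; lia.
Qed.

Lemma inner_coefE k j i : (j <= k)%N ->
  \sum_(Lbound i k <= p < (k - j).+1)
    ((assoc_stirling2 (p + k - j) p)%:R *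
       \sum_(0 <= b < j.+1)
         (binomZ p%:Z b%:Z * binomZ k%:Z (j%:Z - b%:Z) *
            binomZ b%:Z (k%:Z + p%:Z - i%:Z))) = (inner_coef k j i)%:R.
Proof.
move=> jk; rewrite /Lbound max0n (@big_nat_widenl _ _ _ _ 0) //= big_mkord.
rewrite natr_sum big_mkcond; apply: eq_bigr => p _ /=.
rewrite big_mkord addnBA // natrM natr_sum.
case: leqP => [ip|pi]; last first.
  rewrite big1 ?mulr0 // => b _.
  by case: ifP => ik; rewrite ?muln0 //; lia.
congr (_ * _); apply: eq_bigr => b _.
have bj : (b <= j)%N by rewrite -ltnS.
have -> : j%:Z - b%:Z = (j - b)%N%:Z by lia.
case: leqP => [ik|ki]; last by lia.
have -> : k%:Z + p%:Z - i%:Z = (k + p - i)%N%:Z by lia.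
by rewrite !bin_natE !natrM.
Qed.

(** Vandermonde over i yields C(m + b, k + p), [sum_bin3] then sums over b, and the remaining sum
    over p is [stirling2c]. *)
Lemma sum_inner_coef m k j : (j <= k)%N ->
  (\sum_(i < (2 * k).+1) 'C(m, i) * inner_coef k j i
   = 'C(m + j - k, j) * stirling2c m (k - j))%N.
Proof.
move=> jk; rewrite /stirling2c big_distrr /=.
under eq_bigr => i _ do rewrite /inner_coef big_distrr /=.
rewrite exchange_big /=; apply: eq_bigr => p _.
rewrite [RHS]mulnCA [X in _ = (_ * X)%N]mulnC -(sum_bin3 m k p j jk) big_distrr /=.
transitivity (\sum_(i < (2 * k).+1) \sum_(b < j.+1)
   assoc_stirling2 (p + (k - j)) p * ('C(p, b) * 'C(k, j - b)) *
    (if i <= k + p then 'C(m, i) * 'C(b, k + p - i) else 0))%N.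
  apply: eq_bigr => i _; rewrite !big_distrr /=.
  by apply: eq_bigr => b _; case: ifP => _; ring.
rewrite exchange_big /=; apply: eq_bigr => b _.
rewrite -big_distrr /= -mulnA; congr (_ * _)%N; congr (_ * _)%N.
rewrite -big_mkcond -binomial.Vandermonde /=.
have pk : ((k + p).+1 <= (2 * k).+1)%N by have := ltn_ord p; lia.
by rewrite [RHS](big_ord_widen _ (fun i => 'C(m, i) * 'C(b, k + p - i))%N pk).
Qed.

(** The sum over d collapses to the falling factorial i! C(m, i), after which [sum_inner_coef]
    performs the sum over i. *)
Lemma sum_c_coef m k :
  \sum_(0 <= d < (2 * k).+1) c_coef d k * m%:R ^+ d
  = \sum_(j < (uphalf k).+1) (chebpoly k.+1)`_j
      * (j`! * 'C(m + j - k, j) * stirling2c m (k - j))%:R.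
Proof.
have up_le : (uphalf k <= k)%N by lia.
pose g i := \sum_(j < (uphalf k).+1) alpha k j * (inner_coef k j i)%:R.
have gE i : \sum_(0 <= j < (Ubound i k).+1) (alpha k j *
    \sum_(Lbound i k <= p < (k - j).+1) ((assoc_stirling2 (p + k - j) p)%:R *
       \sum_(0 <= b < j.+1) (binomZ p%:Z b%:Z * binomZ k%:Z (j%:Z - b%:Z) *
            binomZ b%:Z (k%:Z + p%:Z - i%:Z)))) = g i.
  rewrite /g -(big_mkord xpredT (fun j => alpha k j * (inner_coef k j i)%:R)).
  rewrite [RHS](@big_cat_nat _ _ _ (Ubound i k).+1) //=; last by rewrite ltnS geq_minl.
  rewrite [X in _ = _ + X]big_nat [X in _ = _ + X]big1 ?addr0.
    apply: eq_big_nat => j /andP[_ jU]; rewrite inner_coefE //.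
    by move: jU; rewrite /Ubound; lia.
  move=> j /andP[Uj ju]; rewrite inner_coef_eq0 ?mulr0 //; first by lia.
  by move: Uj ju; rewrite /Ubound; lia.
have cE d : c_coef d k * m%:R ^+ d = \sum_(i < (2 * k).+1)
    (-1) ^+ (i - d) * (stirling1 i d)%:R * m%:R ^+ d * ((i`!%:R)^-1 * g i).
  rewrite /c_coef (@big_nat_widenl _ _ _ _ 0) //= big_mkord big_mkcond mulr_suml.
  apply: eq_bigr => i _ /=; case: leqP => [di|id]; last first.
    by rewrite stirling1_small // !mulr0 !mul0r.
  by rewrite gE; ring.
rewrite big_mkord (eq_bigr _ (fun d _ => cE _)) exchange_big /=.
transitivity (\sum_(i < (2 * k).+1) ('C(m, i))%:R * g i).
  apply: eq_bigr => i _; rewrite -mulr_suml sum_stirling1 // prod_natB natrM.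
  rewrite mulrCA -!mulrA mulKf //.
  by rewrite pnatr_eq0 -lt0n fact_gt0.
rewrite /g; under [LHS]eq_bigr => i _ do rewrite mulr_sumr.
rewrite exchange_big /=; apply: eq_bigr => j _.
have ju : (j <= uphalf k)%N by rewrite -ltnS.
rewrite -mulnA natrM -sum_inner_coef; last exact: leq_trans ju up_le.
rewrite mulrA -alphaE // natr_sum mulr_sumr; apply: eq_bigr => i _.
by rewrite natrM; ring.
Qed.

(** With n = m - k, n! j! C(n + j, j) = (n + j)! is the factorial in [umbral_Xn] for
    ['X^(n + j)]. *)
Lemma sum_c_coef_umbral m k : (k <= m)%N ->
  (m - k)`!%:R * \sum_(0 <= d < (2 * k).+1) c_coef d k * m%:R ^+ d
  = umbral m ('X^(m - k) * chebpoly k.+1).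
Proof.
move=> km; rewrite sum_c_coef.
have chebE : chebpoly k.+1 = \sum_(j < (uphalf k).+1) (chebpoly k.+1)`_j *: 'X^j.
  rewrite -poly_def; apply/polyP => i; rewrite coef_poly; case: ltnP => // lt.
  by rewrite nth_default // (leq_trans (size_chebpoly _)).
rewrite [in RHS]chebE !mulr_sumr umbral_sum; apply: eq_bigr => j _.
have ju : (j <= uphalf k)%N by rewrite -ltnS.
have up_le : (uphalf k <= k)%N by lia.
have jk := leq_trans ju up_le.
rewrite -scalerAr umbralZ -exprD (_ : m - k + j = m - (k - j))%N; last by lia.
rewrite umbral_Xn; last by lia.
rewrite mulrCA -natrM; congr (_ * _%:R).
have := @bin_fact (m - (k - j)) j ltac:(lia).
rewrite (_ : m - (k - j) - j = m - k)%N; last by lia.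
rewrite (_ : m + j - k = m - (k - j))%N; last by lia.
by move=> <-; ring.
Qed.

Lemma sum_c_coef_eq0 m k : (m < k)%N ->
  \sum_(0 <= d < (2 * k).+1) c_coef d k * m%:R ^+ d = 0.
Proof.
move=> mk; rewrite sum_c_coef big1 // => -[[|j] jk] _ /=.
  by rewrite stirling2c_diag_eq0 ?muln0 ?mulr0 //; lia.
by rewrite (@bin_small (m + j.+1 - k)) ?muln0 ?mul0n ?mulr0 //; lia.
Qed.

Lemma sum_c_coef_wordtotal m k :
  \sum_(0 <= d < (2 * k).+1) c_coef d k * m%:R ^+ d = wordtotal m k.
Proof.
have [km|mk] := leqP k m; last by rewrite sum_c_coef_eq0 ?wordtotal_eq0.
have f0 : ((m - k)`!%:R : rat) != 0 by rewrite pnatr_eq0 -lt0n fact_gt0.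
apply: (mulfI f0); rewrite sum_c_coef_umbral //.
by have := wordtotal_umbral (m - k) k; rewrite subnK.
Qed.

(** * Labellings of the rows and their weights *)

(* A labelling of the rows: [Some true] for a low cell, [Some false] for a high
   cell, [None] for an empty row. *)
Definition word (m : nat) := {ffun 'I_m -> option bool}.

Definition letter_count (m : nat) (w : word m) (c : bool) : nat :=
  (\sum_(t < m) (w t == Some c))%N.

(* The number of diagonals in row i blocked by cells of the same kind in the
   rows whose low (resp. high) part is contained in that of row i. *)
Definition conflicts (m : nat) (w : word m) (c : bool) (i : 'I_m) : nat :=
  (\sum_(t < m) ((if c then t < i else i < t) && (w t == Some c)))%N.

Definition letter_weight (m : nat) (a b : rat) (w : word m) (i : 'I_m) : rat :=
  if w i is Some c then
    (if c then a + i%:R else b + (m - i.+1)%N%:R) - (conflicts m w c i)%:R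
  else 1.

Definition cons_word (m : nat) (cw : option bool * word m) : word m.+1 :=
  [ffun i => if unlift ord0 i is Some t then cw.2 t else cw.1].

Lemma cons_word0 m c w : cons_word m (c, w) ord0 = c.
Proof. by rewrite ffunE unlift_none. Qed.

Lemma cons_wordS m c w i : cons_word m (c, w) (lift ord0 i) = w i.
Proof. by rewrite ffunE liftK. Qed.

Lemma cons_word_bij m : bijective (cons_word m).
Proof.
exists (fun w : word m.+1 => (w ord0, [ffun i => w (lift ord0 i)] : word m)).
  move=> [c w]; rewrite cons_word0; congr (_, _).
  by apply/ffunP => i; rewrite ffunE cons_wordS.
move=> w; apply/ffunP => i; rewrite ffunE /=.
by case: unliftP => [t|] ->; rewrite ?ffunE.
Qed.

Lemma letter_count_cons m c w d :
  letter_count m.+1 (cons_word m (c, w)) d = ((c == Some d) + letter_count m w d)%N.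
Proof.
rewrite /letter_count big_ord_recl cons_word0; congr (_ + _)%N.
by apply: eq_bigr => t _; rewrite cons_wordS.
Qed.

(** Renumbering the rows from the second one raises a by one; a low first cell takes this back,
    since its diagonal meets the low part of every later row. A high first cell is never counted in
    the conflicts of a later row. *)
Lemma letter_weight_consS m a b c w i :
  letter_weight m.+1 a b (cons_word m (c, w)) (lift ord0 i)
  = letter_weight m (a + 1 - (c == Some true)%:R) b w i.
Proof.
rewrite /letter_weight cons_wordS; case: (w i) => [[]|] //.
  have -> : conflicts m.+1 (cons_word m (c, w)) true (lift ord0 i)
    = ((c == Some true) + conflicts m w true i)%N.
    rewrite /conflicts big_ord_recl cons_word0; congr (_ + _)%N.
    by apply: eq_bigr => t _; rewrite cons_wordS !lift0.
  by rewrite lift0 natrD; ring.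
have -> : conflicts m.+1 (cons_word m (c, w)) false (lift ord0 i)
    = conflicts m w false i.
  rewrite /conflicts big_ord_recl add0n.
  by apply: eq_bigr => t _; rewrite cons_wordS !lift0.
by rewrite lift0 subSS.
Qed.

Lemma letter_weight_cons0 m a b c w :
  letter_weight m.+1 a b (cons_word m (c, w)) ord0 =
  if c is Some d then if d then a else b + m%:R - (letter_count m w false)%:R
  else 1.
Proof.
rewrite /letter_weight cons_word0; case: c => [[]|] //.
  by rewrite /conflicts big1 //=; ring.
rewrite /conflicts big_ord_recl add0n subn1 /=; congr (_ - _%:R).
by apply: eq_bigr => t _; rewrite cons_wordS.
Qed.

Lemma wordsumE m u l a b :
  wordsum m u l a b =
  \sum_(w : word m | (letter_count m w true == l) && (letter_count m w false == u))
     \prod_(i < m) letter_weight m a b w i.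
Proof.
elim: m u l a b => [|m IH] u l a b.
  rewrite /= big_mkcond (eq_bigr (fun=> ((u == 0%N) && (l == 0%N))%:R)).
    by rewrite sumr_const card_ffun card_ord expn0.
  move=> w _; rewrite /letter_count !big_ord0 ![_ == 0%N]eq_sym andbC.
  by case: ifP.
rewrite wordsumS.
rewrite (reindex (cons_word m)); last exact: onW_bij (cons_word_bij m).
pose F c w := if (letter_count m.+1 (cons_word m (c, w)) true == l)
      && (letter_count m.+1 (cons_word m (c, w)) false == u)
   then \prod_(i < m.+1) letter_weight m.+1 a b (cons_word m (c, w)) i else 0.
rewrite big_mkcond (eq_bigr (fun cw => F cw.1 cw.2)); last by case.
rewrite -(pair_big xpredT xpredT F) /=.
rewrite (bigD1 None) // (bigD1 (Some true)) // (bigD1 (Some false)) //=.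
rewrite [X in _ + (_ + (_ + X))]big_pred0 ?addr0; last by case=> [[]|].
rewrite addrA; congr (_ + _ + _); rewrite /F.
- rewrite IH big_mkcond; apply: eq_bigr => w _; rewrite !letter_count_cons !add0n.
  case: ifP => // _; rewrite big_ord_recl letter_weight_cons0 mul1r.
  by apply: eq_bigr => i _; rewrite letter_weight_consS subr0.
- case: l {F} => [|l]; first by rewrite big1 // => w _; rewrite !letter_count_cons.
  rewrite IH big_mkcond mulr_sumr; apply: eq_bigr => w _.
  rewrite !letter_count_cons add0n add1n eqSS.
  case: ifP => _; last by rewrite mulr0.
  rewrite big_ord_recl letter_weight_cons0; congr (_ * _).
  by apply: eq_bigr => i _; rewrite letter_weight_consS addrK.
- case: u {F} => [|u].
    by rewrite big1 // => w _; rewrite !letter_count_cons andbF.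
  rewrite IH big_mkcond mulr_sumr; apply: eq_bigr => w _.
  rewrite !letter_count_cons add0n add1n eqSS.
  case: ifP => [/andP[_ /eqP wu]|_]; last by rewrite mulr0.
  rewrite big_ord_recl letter_weight_cons0 wu; congr (_ * _).
  by apply: eq_bigr => i _; rewrite letter_weight_consS subr0.
Qed.

(** * Sets of cells with a given labelling *)

Definition low_cell (m : nat) (x : 'I_m * 'I_m) : bool := (x.2 <= x.1)%N.

Definition cell_diff (m : nat) (x : 'I_m * 'I_m) : int :=
  (x.1 : nat)%:Z - (x.2 : nat)%:Z.

Definition has_word (m : nat) (S : {set 'I_m * 'I_m}) (w : word m) : bool :=
  [forall x in S, w x.1 == Some (low_cell m x)] &&
  [forall i, (w i != None) ==> [exists x in S, x.1 == i]].

Lemma admissibleSP m (S : {set 'I_m * 'I_m}) :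
  reflect ({in S &, injective (fun x => x.1)} /\ {in S &, injective (cell_diff m)})
          (admissibleS S).
Proof.
apply: (iffP idP) => [adm|[inj1 inj2]].
  have adm2 x y : x \in S -> y \in S -> x != y ->
    (x.1 != y.1) && (cell_diff m x != cell_diff m y).
    by move=> xS yS; move/forall_inP/(_ x xS)/forall_inP/(_ y yS)/implyP: adm; apply.
  split=> x y xS yS e; apply/eqP/negP => /negP ne;
    have := adm2 x y xS yS ne; by rewrite e eqxx ?andbF.
apply/forall_inP => x xS; apply/forall_inP => y yS; apply/implyP => ne.
by apply/andP; split; apply: contra ne => /eqP e; apply/eqP; [apply: inj1|apply: inj2].
Qed.

Lemma has_wordP m (S : {set 'I_m * 'I_m}) (w : word m) :
  reflect ((forall x, x \in S -> w x.1 = Some (low_cell m x)) /\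
           (forall i, w i <> None -> exists2 x, x \in S & x.1 = i))
          (has_word m S w).
Proof.
apply: (iffP andP) => [[/forall_inP h1 /forallP h2]|[h1 h2]]; split.
- by move=> x /h1/eqP.
- move=> i /eqP wi; have := implyP (h2 i) wi.
  by case/exists_inP => x xS /eqP <-; exists x.
- by apply/forall_inP => x /h1 ->.
apply/forallP => i; apply/implyP => /eqP/h2 [x xS <-].
by apply/exists_inP; exists x.
Qed.

Lemma letter_countE m (w : word m) c :
  letter_count m w c = #|[set i | w i == Some c]|.
Proof.
rewrite /letter_count -sum1_card [RHS]big_mkcond; apply: eq_bigr => i _.
by rewrite inE; case: eqP.
Qed.

Lemma card_cells_of_letter m (S : {set 'I_m * 'I_m}) w c :
  admissibleS S -> has_word m S w ->
  #|[set x in S | low_cell m x == c]| = letter_count m w c.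
Proof.
move=> /admissibleSP[inj1 _] /has_wordP[h1 h2]; rewrite letter_countE.
rewrite -(@card_in_imset _ _ (fun x => x.1)); last first.
  by move=> x y; rewrite !inE => /andP[xS _] /andP[yS _]; apply: inj1.
apply: eq_card => i; rewrite inE; apply/imsetP/eqP.
  by case=> x; rewrite inE => /andP[xS /eqP xc] ->; rewrite h1 // xc.
move=> wi; have [|x xS xi] := h2 i; first by rewrite wi.
by exists x; rewrite // inE xS; have := h1 x xS; rewrite xi wi => -[->] /=.
Qed.

Lemma card_admissible m (S : {set 'I_m * 'I_m}) w :
  admissibleS S -> has_word m S w ->
  #|S| = (letter_count m w true + letter_count m w false)%N.
Proof.
move=> adm hw; rewrite -!(card_cells_of_letter m S w) //.
rewrite -cardsUI; have -> : [set x in S | low_cell m x == true]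
  :&: [set x in S | low_cell m x == false] = set0.
  by apply/setP => x; rewrite !inE; case: (low_cell m x); rewrite ?andbF.
rewrite cards0 addn0; apply: eq_card => x; rewrite !inE.
by case: (low_cell m x); rewrite ?andbT ?andbF ?orbF.
Qed.

Definition placements (m : nat) (w : word m) : {set {set 'I_m * 'I_m}} :=
  [set S | admissibleS S && has_word m S w].

Definition erase (m : nat) (w : word m) (r : 'I_m) : word m :=
  [ffun i => if i == r then None else w i].

Definition free_cells (m : nat) (S : {set 'I_m * 'I_m}) (r : 'I_m) (c : bool) :=
  [set y : 'I_m * 'I_m | [&& y.1 == r, low_cell m y == c &
     [forall x in S, cell_diff m x != cell_diff m y]]].

(** Deleting the cell of row r maps onto placements of the erased word; the fibre over S consists of
    the sets [y |: S] with y a free cell of row r. *)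
Lemma card_placements_erase m (w : word m) r c : w r = Some c ->
  #|placements m w| = (\sum_(S in placements m (erase m w r)) #|free_cells m S r c|)%N.
Proof.
move=> wr; pose restr (S : {set 'I_m * 'I_m}) := [set x in S | x.1 != r].
rewrite -sum1_card (partition_big restr (mem (placements m (erase m w r)))) /=.
  apply: eq_bigr => T; rewrite inE => /andP[admT /has_wordP[hT1 hT2]].
  have [injT1 injT2] := admissibleSP m T admT.
  have Tr x : x \in T -> x.1 != r.
    by move=> /hT1; rewrite ffunE; case: eqP.
  rewrite sum1dep_card -(@card_in_imset _ _ (fun y => y |: T)); last first.
    move=> y z; rewrite !inE => /andP[/eqP yr _] _ e.
    have : y \in z |: T by rewrite -e setU11.
    by rewrite !inE => /orP[/eqP|/Tr] //; rewrite yr eqxx.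
  apply: eq_card => S; rewrite !inE; apply/idP/imsetP.
    case/andP=> /andP[/admissibleSP[inj1 inj2] /has_wordP[h1 h2]] /eqP eT.
    have [|y yS yr] := h2 r; first by rewrite wr.
    exists y; last first.
      apply/setP => x; rewrite -eT !inE; have [xr|xr] := eqVneq x.1 r.
        rewrite andbF orbF; apply/idP/eqP => [xS|-> //].
        by apply: inj1; rewrite // xr yr.
      by rewrite andbT; have [->|] := eqVneq x y; rewrite ?yS.
    rewrite inE yr eqxx /=; apply/andP; split.
      by have := h1 y yS; rewrite yr wr => -[->].
    apply/forall_inP => x; rewrite -eT inE => /andP[xS xr].
    by apply: contra xr => /eqP e; rewrite (inj2 x y) // yr.
  case=> y; rewrite inE => /and3P[/eqP yr /eqP yc /forall_inP yd] ->{S}.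
  apply/andP; split; [apply/andP; split|].
  - apply/admissibleSP; split=> x z; rewrite !inE.
      case/orP=> [/eqP->|xT] /orP[/eqP->|zT] // e.
      + by move: (Tr z zT); rewrite -e yr eqxx.
      + by move: (Tr x xT); rewrite e yr eqxx.
      + exact: injT1.
    case/orP=> [/eqP->|xT] /orP[/eqP->|zT] // e.
    + by move: (yd z zT); rewrite e eqxx.
    + by move: (yd x xT); rewrite e eqxx.
    + exact: injT2.
  - apply/has_wordP; split=> [x|i wi].
      rewrite !inE => /orP[/eqP->|xT]; first by rewrite yr wr yc.
      by rewrite -hT1 // ffunE (negbTE (Tr x xT)).
    have [->|ir] := eqVneq i r; first by exists y; rewrite ?setU11.
    have [|x xT xi] := hT2 i; first by rewrite ffunE (negbTE ir).
    by exists x; rewrite // !inE xT orbT.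
  - apply/eqP/setP => x; rewrite !inE; have [->|xy] := eqVneq x y.
      rewrite yr eqxx /=; apply/esym/negP => /Tr; by rewrite yr eqxx.
    by apply/andP/idP => [[]|xT] //; rewrite xT Tr.
move=> S; rewrite !inE => /andP[/admissibleSP[inj1 inj2] /has_wordP[h1 h2]].
apply/andP; split.
  apply/admissibleSP; split=> x y; rewrite !inE => /andP[xS _] /andP[yS _].
    exact: inj1.
  exact: inj2.
apply/has_wordP; split=> [x|i].
  by rewrite inE => /andP[xS xr]; rewrite ffunE (negbTE xr) h1.
rewrite ffunE; have [//|ir] := eqVneq i r.
by case/h2=> x xS xi; exists x; rewrite // inE xS xi.
Qed.

Lemma card_row_cells m (r : 'I_m) c :
  #|[set y : 'I_m * 'I_m | (y.1 == r) && (low_cell m y == c)]|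
  = (if c then r.+1 else m - r.+1)%N.
Proof.
have lowE : #|[set j : 'I_m | (j <= r)%N]| = r.+1.
  rewrite -[RHS](card_ord r.+1) -(@card_imset _ _ (widen_ord (ltn_ord r))); last first.
    by move=> i j /(congr1 val) /= e; apply: val_inj.
  apply: eq_card => j; rewrite inE; apply/idP/imsetP => [jr|[i _ ->]].
    by exists (Ordinal (jr : (j < r.+1)%N)) => //; apply: val_inj.
  by rewrite /= -ltnS.
have -> : #|[set y : 'I_m * 'I_m | (y.1 == r) && (low_cell m y == c)]|
    = #|[set j : 'I_m | (j <= r)%N == c]|.
  rewrite -(@card_imset _ _ (fun j : 'I_m => (r, j))); last by move=> i j [].
  apply: eq_card => -[y1 y2]; rewrite inE; apply/idP/imsetP => /=.
    by case/andP=> /eqP-> yc; exists y2; rewrite ?inE.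
  by case=> j; rewrite inE => jc [-> ->]; rewrite eqxx.
case: c.
  by rewrite -[RHS]lowE; apply: eq_card => j; rewrite !inE eqb_id.
rewrite -[X in (X - _)%N](card_ord m) -cardsT -lowE -cardsDS ?subsetT //.
by apply: eq_card => j; rewrite !inE andbT eqbF_neg.
Qed.

(** Sliding the cells of kind c along their diagonals into row r is injective, and the free cells
    are the complement of the image. *)
Lemma card_free_cells m (S : {set 'I_m * 'I_m}) (w : word m) (r : 'I_m) c :
  admissibleS S -> has_word m S w ->
  (forall x, x \in S -> low_cell m x = c -> if c then x.1 <= r else r <= x.1)%N ->
  (#|free_cells m S r c| + letter_count m w c = if c then r.+1 else m - r.+1)%N.
Proof.
move=> adm hw nested; have [inj1 inj2] := admissibleSP m S adm.
rewrite -(card_cells_of_letter m S w c adm hw) -card_row_cells.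
set B := [set x in S | _]; set K := [set y | _ && _].
pose shift (x : 'I_m * 'I_m) : 'I_m * 'I_m := (r, insubd r (x.2 + r - x.1)%N).
(* By [nested] the slid cell stays on the board, so the default value of [insubd] never occurs. *)
have shiftE x : x \in B -> ((shift x).2 = x.2 + r - x.1 :> nat)%N.
  rewrite inE => /andP[xS /eqP xc]; rewrite insubdK // unfold_in /=.
  have := nested x xS xc.
  have := ltn_ord x.2; have := ltn_ord r; have := ltn_ord x.1.
  by move: xc; rewrite /low_cell; case: c {nested B K} => /=; lia.
have shift_diff x : x \in B -> cell_diff m (shift x) = cell_diff m x.
  move=> xB; rewrite /cell_diff shiftE //=.
  move: xB; rewrite inE => /andP[xS /eqP xc]; have := nested x xS xc.
  have := ltn_ord x.2; have := ltn_ord r; have := ltn_ord x.1.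
  by move: xc; rewrite /low_cell; case: c {nested B K shiftE} => /=; lia.
(* The diagonal determines the kind, so cells of the other kind block nothing here. *)
have diff_low x : low_cell m x = (0 <= cell_diff m x).
  by rewrite /low_cell /cell_diff subr_ge0 lez_nat.
have row_inj x y : x.1 = y.1 -> cell_diff m x = cell_diff m y -> x = y.
  case: x y => x1 x2 [y1 y2] /= ->; rewrite /cell_diff /= => e.
  by congr (_, _); apply: val_inj => /=; lia.
have shift_inj : {in B &, injective shift}.
  move=> x y xB yB e; have := shift_diff x xB; rewrite e shift_diff // => e'.
  by apply: inj2; [move: xB|move: yB|]; rewrite ?inE => // /andP[].
have sBK : shift @: B \subset K.
  apply/subsetP => _ /imsetP[x xB ->]; rewrite inE eqxx /= diff_low shift_diff //.
  by rewrite -diff_low; move: xB; rewrite inE => /andP[].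
rewrite -(card_in_imset shift_inj) -[RHS](cardsID (shift @: B)) addnC.
congr (_ + _)%N; first by rewrite (setIidPr sBK).
apply: eq_card => y; rewrite !inE; apply/and3P/and3P => -[].
  move=> yr yc /forall_inP yd; split=> //; apply/imsetP => -[x xB e].
  have xS : x \in S by move: xB; rewrite inE => /andP[].
  by have := yd x xS; rewrite e shift_diff // eqxx.
move=> ysh yr yc; split=> //; apply/forall_inP => x xS.
apply: contra ysh => /eqP e; apply/imsetP.
have xB : x \in B by rewrite inE xS diff_low e -diff_low.
by exists x => //; apply: row_inj; rewrite ?shift_diff // (eqP yr).
Qed.

Lemma letter_count_erase m (w : word m) (r : 'I_m) c : w r = Some c ->
  (forall t, w t = Some c -> if c then t <= r else r <= t)%N ->
  letter_count m (erase m w r) c = conflicts m w c r.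
Proof.
move=> wr ext; apply: eq_bigr => t _; rewrite ffunE.
have [->|tr] := eqVneq t r; first by rewrite !ltnn if_same.
case: eqP => [wt|]; rewrite ?andbF // andbT.
have := ext t wt; have : (t : nat) != r by [].
by case: c {wr ext wt}; lia.
Qed.

Lemma letter_weight_erase m a b (w : word m) (r i : 'I_m) c : w r = Some c ->
  (forall t, w t = Some c -> if c then t <= r else r <= t)%N -> i != r ->
  letter_weight m a b (erase m w r) i = letter_weight m a b w i.
Proof.
move=> wr ext ir; rewrite /letter_weight ffunE (negbTE ir).
case wi: (w i) => [d|] //; congr (_ - _%:R); apply: eq_bigr => t _.
rewrite ffunE; have [->|//] := eqVneq t r.
rewrite wr andbF; case: eqP => [[cd]|]; last by rewrite andbF.
rewrite -cd in wi *; have := ext i wi; case: c {wr ext wi cd} => le;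
  by rewrite andbT ltnNge le.
Qed.

(** Induction on the number of non-empty rows, erasing the last low row or the first high row: such
    a row is in no other row's [conflicts], so the other weights do not change. *)
Lemma card_placements m (w : word m) :
  (#|placements m w|)%:R = \prod_(i < m) letter_weight m 1 0 w i.
Proof.
move En : #|[set i | w i != None]| => n; elim: n w En => [|n IH] w En.
  have w0 i : w i = None.
    by apply/eqP; move/eqP: En; rewrite cards_eq0 => /eqP/setP/(_ i); rewrite !inE => /negbFE.
  rewrite big1 => [|i _]; last by rewrite /letter_weight w0.
  have -> : placements m w = [set set0]; last by rewrite cards1.
  apply/setP => S; rewrite !inE; apply/andP/eqP => [[_ /has_wordP[h1 _]]|->].
    by apply/setP => x; rewrite inE; apply/negP => /h1; rewrite w0.
  split; first by apply/admissibleSP; split=> x y; rewrite inE.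
  by apply/has_wordP; split=> [x|i]; rewrite ?inE ?w0.
have [r [c [wr ext]]] : exists r c, w r = Some c /\
    (forall t, w t = Some c -> if c then t <= r else r <= t)%N.
  have /set0Pn[s] : [set i | w i != None] != set0 by rewrite -card_gt0 En.
  rewrite inE; case ws: (w s) => [[]|] // _.
    have Ps : (fun t => w t == Some true) s by rewrite ws.
    exists [arg max_(t > s | w t == Some true) (t : nat)], true.
    by case: arg_maxnP => // r /eqP wr ext; split=> // t /eqP/ext.
  exists [arg min_(t < s | w t == Some false) (t : nat)], false.
  by case: arg_minnP => [|r /eqP wr ext]; rewrite ?ws //; split=> // t /eqP/ext.
(* Row r has the largest part of its kind, so every diagonal used by another cell
   of this kind meets it: the number of free cells does not depend on T. *)
rewrite (card_placements_erase m w r c wr).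
have freeE T : T \in placements m (erase m w r) ->
    (#|free_cells m T r c|%:R : rat) = letter_weight m 1 0 w r.
  rewrite inE => /andP[adm hw].
  rewrite /letter_weight wr -letter_count_erase //.
  apply/eqP; rewrite eq_sym subr_eq -natrD (card_free_cells m T (erase m w r)) //.
    by case: (c); rewrite ?add0r // -natr1 addrC.
  move=> x xT xc; apply: ext; have [h1 _] := has_wordP m T _ hw.
  by have := h1 x xT; rewrite ffunE xc; case: eqP.
rewrite natr_sum (eq_bigr _ freeE) sumr_const -mulr_natl IH.
  rewrite [RHS](bigD1 r) //= (bigD1 r) //= {1}/letter_weight ffunE eqxx mul1r mulrC.
  congr (_ * _); apply: eq_bigr => i ir; exact: letter_weight_erase wr ext ir.
apply/eqP; rewrite -eqSS -En [eqbRHS](cardsD1 r) inE wr /= add1n eqSS; apply/eqP.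
by apply: eq_card => i; rewrite !inE ffunE; case: (i == r).
Qed.

(** * Admissible sets sorted by their labelling *)

Definition word_of (m : nat) (S : {set 'I_m * 'I_m}) : word m :=
  [ffun i => if [pick x in S | x.1 == i] is Some x then Some (low_cell m x) else None].

Lemma has_word_of m (S : {set 'I_m * 'I_m}) (w : word m) :
  admissibleS S -> has_word m S w = (word_of m S == w).
Proof.
move=> /admissibleSP[inj1 _]; apply/has_wordP/eqP => [[h1 h2]|<-].
  apply/ffunP => i; rewrite ffunE; case: pickP => [x /andP[xS /eqP <-]|no].
    by rewrite h1.
  case wi: (w i) => [c|] //; have [|x xS xi] := h2 i; first by rewrite wi.
  by have := no x; rewrite xS xi eqxx.
split=> [x xS|i].
  rewrite ffunE; case: pickP => [y /andP[yS /eqP yx]|/(_ x)]; last by rewrite xS eqxx.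
  by rewrite (inj1 y x yS xS yx).
by rewrite ffunE; case: pickP => // x /andP[xS /eqP xi] _; exists x.
Qed.

Lemma A_S_wordtotal m k : (A_S m k)%:R = wordtotal m k.
Proof.
have cardE : A_S m k = (\sum_(w : word m |
    letter_count m w true + letter_count m w false == k) #|placements m w|)%N.
  rewrite /A_S -sum1_card (partition_big (word_of m) xpredT) //= [RHS]big_mkcond.
  apply: eq_bigr => w _; case: eqP => [wk|wk].
    rewrite sum1dep_card; apply: eq_card => S; rewrite !inE.
    case adm: (admissibleS S); rewrite ?andbF //= andbT has_word_of //.
    have [hw|_] := eqVneq (word_of m S) w; rewrite ?andbF // ?andbT.
    by rewrite (card_admissible m S w) ?has_word_of ?wk ?hw ?eqxx.
  rewrite big1 // => S; rewrite !inE => /andP[/andP[/eqP Sk adm] hw]; case: wk.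
  by rewrite -Sk (card_admissible m S w) ?has_word_of.
rewrite cardE natr_sum (eq_bigr _ (fun w _ => card_placements m w)).
rewrite /wordtotal /antidiag.
rewrite (eq_bigr _ (fun (l : 'I_k.+1) _ => wordsumE m (k - l) l 1 0)).
under [RHS]eq_bigr => l _ do rewrite big_mkcond.
rewrite exchange_big /= big_mkcond; apply: eq_bigr => w _.
case: eqP => [wk|wk].
  (* A word with k letters contributes to the antidiagonal only at l equal to its number of low
     letters. *)
  have lt : (letter_count m w true < k.+1)%N by lia.
  rewrite (bigD1 (Ordinal lt)) //= [X in _ + X]big1 ?addr0.
    by rewrite eqxx (_ : letter_count m w false == _) //; apply/eqP; lia.
  by move=> l /eqP lne; case: ifP => // /andP[/eqP e _]; case: lne; apply: val_inj.
rewrite big1 // => l _; case: ifP => // /andP[/eqP e1 /eqP e2]; case: wk.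
by have := ltn_ord l; lia.
Qed.

Theorem theorem3p3 (m k : nat) :
  (A_S m k)%:R = \sum_(0 <= d < (2 * k).+1) c_coef d k * (m%:R : rat) ^+ d.
Proof. by rewrite A_S_wordtotal sum_c_coef_wordtotal. Qed.
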